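(* Let $\mathbf P=(P,\leq,0,1)$ be a bounded poset satisfying the Ascending Chain Condition and let $D$ be a deductive system of $\mathbf P$. Then the following hold: (i) $\Theta(D)\cap P^2$ is an equivalence relation on $P$. (ii) $[1]\big(\Theta(D)\cap P^2\big)=D\cap P$. (iii) If $x,y,z\in P$ and $(x,y)\in\Theta(D)$, then $(z\rightarrow x,z\rightarrow y)\in\Theta(D)$ and $(x\rightarrow z,y\rightarrow z)\in\Theta(D)$.
   Context: A poset is bounded if it has a bottom element $0$ and a top element $1$. The Ascending Chain Condition (ACC) says that there is no infinite strictly ascending chain. Singletons are identified with their unique element, i.e. $x$ is written for $\{x\}$; thus, for a relation $\Theta$ on $2^P\setminus\{\emptyset\}$, $\Theta\cap P^2=\{(a,b)\in P^2\mid(\{a\},\{b\})\in\Theta\}$, and for $D\subseteq2^P\setminus\{\emptyset\}$, $D\cap P=\{a\in P\mid\{a\}\in D\}$. $[1]\Phi$ denotes the class of $1$ with respect to the equivalence relation $\Phi$. For $a,b\in P$ and subsets $A,B\subseteq P$: $\operatorname{Max}A$ is the set of all maximal elements of $A$; $L(a,b):=\{x\in P\mid x\leq a\text{ and }x\leq b\}$; $A\leq_1B$ means that for every $x\in A$ there exists $y\in B$ with $x\leq y$. For non-empty subsets $A,B$ of $P$ define $$A\rightarrow B:=\operatorname{Max}\{y\in P\mid L(x,y)\leq_1B\text{ for all }x\in A\};$$ for elements this reads $a\rightarrow b=\operatorname{Max}\{x\in P\mid z\leq b\text{ for all }z\in L(a,x)\}$. These are non-empty subsets of $P$. A deductive system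 of $\mathbf P$ is a subset $D$ of $2^P\setminus\{\emptyset\}$ such that: (i) $1\in D$ (i.e. $\{1\}\in D$); (ii) if $x,y,z,u\in P$, $x\rightarrow y\in D$ and $(x\rightarrow y)\rightarrow(z\rightarrow u)\in D$, then $z\rightarrow u\in D$; (iii) if $x,y,z\in P$ and $x\rightarrow y,\;y\rightarrow x\in D$, then $(z\rightarrow x)\rightarrow(z\rightarrow y)\in D$ and $(x\rightarrow z)\rightarrow(y\rightarrow z)\in D$. For a subset $E$ of $2^P\setminus\{\emptyset\}$, the relation $\Theta(E)$ induced by $E$ is the binary relation on $2^P\setminus\{\emptyset\}$ given by: $(A,B)\in\Theta(E)$ if and only if both $A\rightarrow B\in E$ and $B\rightarrow A\in E$. *)

(* Defs.v *)
From mathcomp Require Import all_boot all_order.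
From mathcomp Require Import boolp classical_sets.

Set Implicit Arguments.
Unset Strict Implicit.
Unset Printing Implicit Defensive.

Import Order.TTheory.

Local Open Scope order_scope.
Local Open Scope classical_set_scope.

Section Poset.
Context {d : Order.disp_t} {P : porderType d}.
Implicit Types (a b x y z u : P) (A B : set P).

Definition ACC (T : porderType d) : Prop :=
  ~ exists f : nat -> T, forall n : nat, f n < f n.+1.

Definition Max A : set P :=
  [set m | A m /\ forall y, A y -> m <= y -> y = m].

Definition lower a b : set P := [set x | x <= a /\ x <= b].

Definition le1 A B : Prop := forall x, A x -> exists2 y, B y & x <= y.

(* Only meaningful for non-empty [A] and [B]. The arrow of two elements is
   [arrow [set a] [set b]], an element being identified with its singleton. *)
Definition arrow A B : set P :=
  Max [set y | forall x, A x -> le1 (lower x y) B].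

Lemma arrow_elt a b :
  arrow [set a] [set b] = Max [set x | forall z, lower a x z -> z <= b].
Proof.
congr Max; apply/seteqP; split=> x /= h.
  by move=> z /(h a erefl z)[_ ->].
by move=> _ -> z /h zb; exists b.
Qed.

(* The relation on non-empty subsets induced by [E]. *)
Definition Theta (E : set (set P)) (A B : set P) : Prop :=
  [/\ A !=set0, B !=set0, E (arrow A B) & E (arrow B A)].

(* Intersections with [P] and with [P ^ 2] under the identification of
   elements with singletons. *)
Definition elts (E : set (set P)) : set P := [set a | E [set a]].

Definition elts_rel (R : set P -> set P -> Prop) (a b : P) : Prop :=
  R [set a] [set b].

Definition eq_class (Phi : P -> P -> Prop) (a : P) : set P := [set b | Phi a b].

End Poset.

Arguments ACC {d} T.

Record deductive_system {d : Order.disp_t} {P : tbPOrderType d}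
    (D : set (set P)) : Prop := DeductiveSystem {
  ded_nonempty : forall A : set P, D A -> A !=set0;
  ded_top : D [set \top];
  ded_mp : forall x y z u : P,
    D (arrow [set x] [set y]) ->
    D (arrow (arrow [set x] [set y]) (arrow [set z] [set u])) ->
    D (arrow [set z] [set u]);
  ded_compat : forall x y z : P,
    D (arrow [set x] [set y]) -> D (arrow [set y] [set x]) ->
    D (arrow (arrow [set z] [set x]) (arrow [set z] [set y])) /\
    D (arrow (arrow [set x] [set z]) (arrow [set y] [set z]))
}.

(* Main.v *)
Require Import Defs.
From mathcomp Require Import all_boot all_order.
From mathcomp Require Import boolp classical_sets.
From Corelib Require Import RelationClasses.

Import Order.TTheory.

Local Open Scope order_scope.
Local Open Scope classical_set_scope.

(** Everything reduces to three computations, [x -> x = 1], [x -> 1 = 1] and [1 -> a = a], and to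
    the closure rules of [D]. The first gives reflexivity, the other two identify the class of [1];
    transitivity is compatibility followed by modus ponens. Since [Theta] also demands non-empty
    arguments, the compatibility claim needs arrows to be non-empty, which is where ACC enters. *)

Lemma Max_nonempty (d : Order.disp_t) (P : porderType d) (S : set P) :
  ACC P -> S !=set0 -> Max S !=set0.
Proof.
move=> accP [s Ss]; apply: contrapT => noMax; apply: accP.
(* The guard [S m] makes a successor exist for every [m], so choice gives a total [f], to be
   iterated from [s]. *)
have /choice[f fP] : forall m, exists m', S m -> S m' /\ m < m'.
  move=> m; apply: contrapT => /forallNP mP; apply: noMax; exists m.
  have Sm : S m by apply: contrapT => nSm; apply: (mP m).
  split=> // y Sy le_my; apply: contrapT => /eqP neq_ym; apply: (mP y) => _.
  by rewrite lt_neqAle eq_sym neq_ym le_my.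
have Sf n : S (iter n f s) by elim: n => //= n /fP[].
by exists (fun n => iter n f s) => n; have [] := fP _ (Sf n).
Qed.

Lemma Max_top (d : Order.disp_t) (P : tPOrderType d) (S : set P) :
  S \top -> Max S = [set \top].
Proof.
move=> St; apply/seteqP; split=> [m [_ /(_ _ St)]|_ ->] /=.
  by move=> <-.
split=> // y _ le1y; apply/eqP.
by rewrite -le1x.
Qed.

Section Arrow.
Context {d : Order.disp_t} {P : tbPOrderType d}.
Implicit Types (x a : P) (A B : set P).

(** [\bot] is always a candidate, because [lower x \bot] contains only [\bot]. *)
Lemma arrow_nonempty A B : ACC P -> B !=set0 -> arrow A B !=set0.
Proof.
move=> accP [b Bb]; apply: Max_nonempty => //; exists \bot => x _ z [_ z0].
exists b => //; apply: le_trans z0 _.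
exact: le0x.
Qed.

Lemma arrow_refl A : arrow A A = [set \top].
Proof. by apply: Max_top => x Ax z [zx _]; exists x. Qed.

Lemma arrow_to_top A : arrow A [set \top] = [set \top].
Proof. by apply: Max_top => x _ z _; exists \top. Qed.

(** [lower \top x] is the principal ideal of [x], so the candidates are exactly the elements below
    [a]. *)
Lemma arrow_from_top a : arrow [set \top] [set a] = [set a].
Proof.
rewrite arrow_elt; apply/seteqP; split=> [m [mP maxm] | _ ->] /=.
  by apply/esym/maxm => [z []//|]; exact: mP.
split=> [z []//|y yP le_ay]; apply/le_anti.
by rewrite le_ay yP.
Qed.

End Arrow.

Theorem theorem5p10 (d : Order.disp_t) (P : tbPOrderType d) (D : set (set P))
    (accP : ACC P) (dedD : deductive_system D) :
  [/\ Equivalence (elts_rel (Theta D)),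
      eq_class (elts_rel (Theta D)) \top = elts D &
      forall x y z : P, Theta D [set x] [set y] ->
        Theta D (arrow [set z] [set x]) (arrow [set z] [set y]) /\
        Theta D (arrow [set x] [set z]) (arrow [set y] [set z])].
Proof.
have Dtop := ded_top dedD.
split.
- split=> [x|x y []|x y z [x0 _ xy yx] [_ z0 yz zy]].
  + by split; rewrite ?arrow_refl //; exists x.
  + by split.
  + split=> //.
    (* Modus ponens on [x -> y] and [(x -> y) -> (x -> z)]. *)
    * by have [+ _] := ded_compat dedD x yz zy; exact: (ded_mp dedD).
    * by have [+ _] := ded_compat dedD z yx xy; exact: (ded_mp dedD).
- apply/seteqP; split=> [a [_ _]|a Da]; first by rewrite arrow_from_top.
  by split; rewrite ?arrow_from_top ?arrow_to_top //; [exists \top|exists a].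
- move=> x y z [_ _ xy yx].
  have [zxy xyz] := ded_compat dedD z xy yx.
  have [zyx yxz] := ded_compat dedD z yx xy.
  by split; split=> //; apply: arrow_nonempty => //; eexists.
Qed.
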